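(* Let $\tau$ be a countable relational vocabulary and $n\geq1$. If a finitary first-order $\tau$-formula $\phi(\bar x)$ is equivalent on all countable $\tau$-structures to a $\Pi^{\mathrm{in}}_n$-formula $\psi(\bar x)$ of $L_{\omega_1\omega}$, then there is a finitary $\forall_n$-formula $\theta(\bar x)$ which is logically equivalent to $\phi(\bar x)$.
   Context: $\Pi^{\mathrm{in}}_n$ denotes the formulas of the infinitary logic $L_{\omega_1\omega}$ at level $\Pi_n$ of the standard hierarchy (countable conjunctions of universally quantified $\Sigma^{\mathrm{in}}_{n-1}$-formulas, with $\Sigma^{\mathrm{in}}_{n-1}$ the countable disjunctions of existentially quantified $\Pi^{\mathrm{in}}_{n-2}$-formulas, and finitary quantifier-free formulas at the bottom). A $\forall_n$-formula is a finitary prenex formula with $n$ alternating quantifier blocks starting with $\forall$. *)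

(* Defs.v *)
From mathcomp Require Import all_boot.
Set Implicit Arguments.
Unset Strict Implicit.
Unset Printing Implicit Defensive.

Section Logic.
Variables (S : countType) (ar : S -> nat).

Inductive form : Type :=
| FEq  : nat -> nat -> form
| FRel : forall s : S, (ar s).-tuple nat -> form
| FNot : form -> form
| FAnd : form -> form -> form
| FOr  : form -> form -> form
| FEx  : nat -> form -> form
| FAll : nat -> form -> form.

Inductive iform : Type :=
| IFin    : form -> iform
| INot    : iform -> iform
| IBigAnd : (nat -> iform) -> iform
| IBigOr  : (nat -> iform) -> iform
| IEx     : nat -> iform -> iform
| IAll    : nat -> iform -> iform.

Record structure := Structure {
  carrier :> Type;
  inhab : carrier;
  interp : forall s : S, (ar s).-tuple carrier -> Prop }.

Definition countable_structure (M : structure) : Prop :=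
  exists f : M -> nat, injective f.

Definition upd (M : Type) (e : nat -> M) (x : nat) (m : M) : nat -> M :=
  fun y => if y == x then m else e y.

Fixpoint sat (M : structure) (e : nat -> M) (f : form) : Prop :=
  match f with
  | FEq x y => e x = e y
  | FRel s t => @interp M s (map_tuple e t)
  | FNot g => ~ sat e g
  | FAnd g h => sat e g /\ sat e h
  | FOr g h => sat e g \/ sat e h
  | FEx x g => exists m : M, sat (upd e x m) g
  | FAll x g => forall m : M, sat (upd e x m) g
  end.

Fixpoint isat (M : structure) (e : nat -> M) (f : iform) : Prop :=
  match f with
  | IFin g => sat e g
  | INot g => ~ isat e g
  | IBigAnd F => forall i, isat e (F i)
  | IBigOr F => exists i, isat e (F i)
  | IEx x g => exists m : M, isat (upd e x m) g
  | IAll x g => forall m : M, isat (upd e x m) g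
  end.

Fixpoint free_in (P : nat -> Prop) (f : form) : Prop :=
  match f with
  | FEq x y => P x /\ P y
  | FRel s t => forall x, x \in val t -> P x
  | FNot g => free_in P g
  | FAnd g h => free_in P g /\ free_in P h
  | FOr g h => free_in P g /\ free_in P h
  | FEx x g => free_in (fun y => y = x \/ P y) g
  | FAll x g => free_in (fun y => y = x \/ P y) g
  end.

Fixpoint ifree_in (P : nat -> Prop) (f : iform) : Prop :=
  match f with
  | IFin g => free_in P g
  | INot g => ifree_in P g
  | IBigAnd F => forall i, ifree_in P (F i)
  | IBigOr F => forall i, ifree_in P (F i)
  | IEx x g => ifree_in (fun y => y = x \/ P y) g
  | IAll x g => ifree_in (fun y => y = x \/ P y) g
  end.

Fixpoint qf (f : form) : bool :=
  match f with
  | FEq _ _ | FRel _ _ => true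
  | FNot g => qf g
  | FAnd g h | FOr g h => qf g && qf h
  | FEx _ _ | FAll _ _ => false
  end.

Definition alls (xs : seq nat) (f : form) : form := foldr FAll f xs.
Definition exs  (xs : seq nat) (f : form) : form := foldr FEx f xs.
Definition ialls (xs : seq nat) (f : iform) : iform := foldr IAll f xs.
Definition iexs  (xs : seq nat) (f : iform) : iform := foldr IEx f xs.

Fixpoint IPi (n : nat) (f : iform) : Prop :=
  match n with
  | 0 => exists g, f = IFin g /\ qf g
  | n'.+1 => exists F : nat -> iform, f = IBigAnd F /\
             forall i, exists xs g, F i = ialls xs g /\ ISigma n' g
  end
with ISigma (n : nat) (f : iform) : Prop :=
  match n with
  | 0 => exists g, f = IFin g /\ qf g
  | n'.+1 => exists F : nat -> iform, f = IBigOr F /\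
             forall i, exists xs g, F i = iexs xs g /\ IPi n' g
  end.

Fixpoint ForallN (n : nat) (f : form) : Prop :=
  match n with
  | 0 => qf f
  | n'.+1 => exists xs g, f = alls xs g /\ ExistsN n' g
  end
with ExistsN (n : nat) (f : form) : Prop :=
  match n with
  | 0 => qf f
  | n'.+1 => exists xs g, f = exs xs g /\ ForallN n' g
  end.

End Logic.

Arguments sat {S ar} M e f.
Arguments isat {S ar} M e f.

(* Main.v *)
Require Import Defs.
From mathcomp Require Import all_boot.
From mathcomp Require Import boolp filter.

(** By Löwenheim-Skolem, [phi] and [psi] are equivalent on all structures.
    Suppose that [phi] has no equivalent forall_n-formula. Then every finite set
    of forall_n-consequences of [phi] has a model of [~ phi]; an ultraproduct
    over nat of such models is an omega_1-saturated [(N, b)] satisfying [~ phi]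
    and all forall_n-consequences of [phi]. Every finite part of the
    exists_n-theory of [(N, b)] is then consistent with [phi], so a second
    ultraproduct is an omega_1-saturated [(M, a)] satisfying [phi], all of whose
    forall_n-formulas hold in [(N, b)]. Between saturated structures,
    preservation of finitary forall_n-formulas passes to infinitary
    Pi_n-formulas by a back-and-forth of length [n], so [psi], hence [phi],
    holds in [(N, b)]: contradiction. *)

Set Implicit Arguments.
Unset Strict Implicit.
Unset Printing Implicit Defensive.

(** * Prenex formulas *)

Section Blocks.
Variable M : Type.
Implicit Type e : nat -> M.

(** A block of quantifiers over [xs], repetitions included, ranges over the assignments that agree
    with [e] off [xs]. *)
Definition agree_off (xs : seq nat) e e' : Prop :=
  forall x, x \notin xs -> e' x = e x.

Lemma agree_off_cons x xs e e' :
  agree_off (x :: xs) e e' <-> exists m, agree_off xs (upd e x m) e'.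
Proof.
split=> [ag|[m ag] y].
  exists (e' x) => y yxs; rewrite /upd; case: eqP => [->//|/eqP yx].
  by apply: ag; rewrite in_cons negb_or yx.
by rewrite in_cons negb_or => /andP[/negbTE yx /ag]; rewrite /upd yx.
Qed.

Lemma agree_off_nil e e' : agree_off [::] e e' <-> e' = e.
Proof. by split=> [ag|->//]; apply: funext => x; apply: ag. Qed.

(** [B] is left abstract so that the same induction serves finitary and infinitary blocks. *)
Lemma all_block (B : seq nat -> (nat -> M) -> Prop) :
  (forall x xs e, B (x :: xs) e <-> forall m, B xs (upd e x m)) ->
  forall xs e, B xs e <-> forall e', agree_off xs e e' -> B [::] e'.
Proof.
move=> Bcons; elim=> [|x xs IH] e.
  by split=> [Be e' /agree_off_nil->//|]; apply; apply/agree_off_nil.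
split=> [/Bcons Be e' /agree_off_cons[m ag]|Be]; first exact: (IH _).1 ag.
apply/Bcons => m; apply/IH => e' ag; apply: Be.
by apply/agree_off_cons; exists m.
Qed.

Lemma ex_block (B : seq nat -> (nat -> M) -> Prop) :
  (forall x xs e, B (x :: xs) e <-> exists m, B xs (upd e x m)) ->
  forall xs e, B xs e <-> exists e', agree_off xs e e' /\ B [::] e'.
Proof.
move=> Bcons; elim=> [|x xs IH] e.
  by split=> [Be|[e' [/agree_off_nil->]]//]; exists e.
split=> [/Bcons[m /IH[e' [ag Be']]]|[e' [/agree_off_cons[m ag] Be']]].
  by exists e'; split=> //; apply/agree_off_cons; exists m.
by apply/Bcons; exists m; apply/IH; exists e'.
Qed.

Lemma upd_comp (T : Type) (h : M -> T) e x m :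
  h \o upd e x m = upd (h \o e) x (h m).
Proof. by apply: funext => y; rewrite /= /upd; case: eqP. Qed.

End Blocks.

(** * Renaming, negation and conjunction of prenex formulas *)

Section Syntax.
Variables (S : countType) (ar : S -> nat).
Implicit Types (f g h : form ar) (M : structure ar) (P Q : nat -> Prop).

Lemma free_in_mono P Q f :
  (forall x, P x -> Q x) -> free_in P f -> free_in Q f.
Proof.
elim: f P Q => /= [x y|s t|g IH|g IHg h IHh|g IHg h IHh|x g IH|x g IH] P Q PQ.
- by case=> /PQ ? /PQ.
- by move=> tP x /tP/PQ.
- exact: IH.
- by case=> /(IHg _ _ PQ) ? /(IHh _ _ PQ).
- by case=> /(IHg _ _ PQ) ? /(IHh _ _ PQ).
- by apply: IH => y [->|/PQ]; [left|right].
- by apply: IH => y [->|/PQ]; [left|right].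
Qed.

Lemma free_in_and P Q f :
  free_in P f -> free_in Q f -> free_in (fun x => P x /\ Q x) f.
Proof.
elim: f P Q => /= [x y|s t|g IH|g IHg h IHh|g IHg h IHh|x g IH|x g IH] P Q.
- by case=> ? ? [].
- by move=> tP tQ x xt; split; auto.
- exact: IH.
- by case=> ? ? [? ?]; auto.
- by case=> ? ? [? ?]; auto.
- move=> fP fQ; apply: free_in_mono (IH _ _ fP fQ) => y [] [->|Py] []; auto.
- move=> fP fQ; apply: free_in_mono (IH _ _ fP fQ) => y [] [->|Py] []; auto.
Qed.

Lemma free_in_true P f : (forall x, P x) -> free_in P f.
Proof. by elim: f P => /=; auto. Qed.

Lemma free_in_bounded f : exists K, free_in (fun x => x < K) f.
Proof.
have bin g h : (exists K, free_in (fun x => x < K) g) ->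
    (exists K, free_in (fun x => x < K) h) ->
    exists K, free_in (fun x => x < K) g /\ free_in (fun x => x < K) h.
  move=> [K gK] [L hL]; exists (maxn K L).
  split; [apply: free_in_mono gK | apply: free_in_mono hL] => x xK;
    by rewrite leq_max xK ?orbT.
have quant x g : (exists K, free_in (fun x => x < K) g) ->
    exists K, free_in (fun y => y = x \/ y < K) g.
  by move=> [K gK]; exists K; apply: free_in_mono gK; auto.
elim: f => /= [x y|s t|g IH|g IHg h IHh|g IHg h IHh|x g IH|x g IH]; auto.
- by exists (maxn x y).+1; rewrite !ltnS leq_maxl leq_maxr.
- by exists (\max_(x <- t) x).+1 => x xt; rewrite ltnS; apply: leq_bigmax_seq.
Qed.

Lemma sat_ext P M (e e' : nat -> M) f :
  free_in P f -> (forall x, P x -> e x = e' x) -> sat M e f = sat M e' f.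
Proof.
elim: f P e e' => /= [x y|s t|g IH|g IHg h IHh|g IHg h IHh|x g IH|x g IH] P e e'.
- by case=> Px Py eq; rewrite !eq.
- move=> tP eq; congr (interp _); apply: val_inj => /=.
  by apply/eq_in_map => x /tP/eq.
- by move=> gP /(IH _ _ _ gP)->.
- by case=> gP hP eq; rewrite (IHg _ _ _ gP eq) (IHh _ _ _ hP eq).
- by case=> gP hP eq; rewrite (IHg _ _ _ gP eq) (IHh _ _ _ hP eq).
- move=> gP eq; congr ex; apply: funext => m; apply: IH gP _ => y.
  by rewrite /upd; case: eqP => // yx [|/eq].
- move=> gP eq; apply: eq_forall => m; apply: IH gP _ => y.
  by rewrite /upd; case: eqP => // yx [|/eq].
Qed.

Fixpoint ren (r : nat -> nat) f : form ar :=
  match f with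
  | FEq x y => FEq ar (r x) (r y)
  | FRel s t => FRel (map_tuple r t)
  | FNot g => FNot (ren r g)
  | FAnd g h => FAnd (ren r g) (ren r h)
  | FOr g h => FOr (ren r g) (ren r h)
  | FEx x g => FEx (r x) (ren r g)
  | FAll x g => FAll (r x) (ren r g)
  end.

(** Injectivity replaces capture avoidance: [r y = r x] only for [y = x], so renaming commutes with
    [upd] at bound variables too. *)
Lemma sat_ren r M (e : nat -> M) f :
  injective r -> sat M e (ren r f) = sat M (e \o r) f.
Proof.
move=> r_inj.
have updr (d : nat -> M) x m : upd d (r x) m \o r = upd (d \o r) x m.
  by apply: funext => y; rewrite /upd /= (inj_eq r_inj).
elim: f e => //= [s t|g IH|g IHg h IHh|g IHg h IHh|x g IH|x g IH] e.
- by congr (interp _); apply: val_inj; rewrite /= -map_comp.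
- by rewrite IH.
- by rewrite IHg IHh.
- by rewrite IHg IHh.
- by congr ex; apply: funext => m; rewrite IH updr.
- by apply: eq_forall => m; rewrite IH updr.
Qed.

Lemma free_in_ren r P f :
  free_in P f -> free_in (fun y => exists2 x, P x & y = r x) (ren r f).
Proof.
elim: f P => /= [x y|s t|g IH|g IHg h IHh|g IHg h IHh|x g IH|x g IH] P.
- by case=> Px Py; split; [exists x | exists y].
- by move=> tP y /mapP[x xt ->]; exists x => //; apply: tP.
- exact: IH.
- by case; auto.
- by case; auto.
- by move/IH; apply: free_in_mono => y [z [->|Pz] ->]; [left|right; exists z].
- by move/IH; apply: free_in_mono => y [z [->|Pz] ->]; [left|right; exists z].
Qed.

(** [true] stands for universal and [false] for existential; the next block has kind [~~ b], so dual
    statements share one proof. *)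
Definition quant (b : bool) xs f := if b then alls xs f else exs xs f.
Definition level (b : bool) n f := if b then ForallN n f else ExistsN n f.

Lemma level0 b f : level b 0 f = qf f.
Proof. by case: b. Qed.

Lemma levelS b n f :
  level b n.+1 f <-> exists xs g, f = quant b xs g /\ level (~~ b) n g.
Proof. by case: b. Qed.

Lemma quant_cat b xs ys f : quant b (xs ++ ys) f = quant b xs (quant b ys f).
Proof. by case: b; rewrite /quant /alls /exs foldr_cat. Qed.

Lemma sat_alls M (e : nat -> M) xs f :
  sat M e (alls xs f) <-> forall e', agree_off xs e e' -> sat M e' f.
Proof. exact: (all_block (B := fun xs e => sat M e (alls xs f))). Qed.

Lemma sat_exs M (e : nat -> M) xs f :
  sat M e (exs xs f) <-> exists e', agree_off xs e e' /\ sat M e' f.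
Proof. exact: (ex_block (B := fun xs e => sat M e (exs xs f))). Qed.

Lemma free_in_quant b xs f P :
  free_in P (quant b xs f) <-> free_in (fun x => x \in xs \/ P x) f.
Proof.
elim: xs P => [|x xs IH] P.
  rewrite (_ : quant b _ _ = f); last by case: b.
  split; apply: free_in_mono => x; by [right | case].
rewrite (_ : free_in P _ = free_in (fun y => y = x \/ P y) (quant b xs f));
  last by case: (b).
apply: (iff_trans (IH _)); split; apply: free_in_mono => y; rewrite in_cons.
  by case=> [->|[->|]]; rewrite ?orbT ?eqxx; auto.
by case=> [/orP[/eqP->|]|]; auto.
Qed.

Lemma ren_quant r b xs f : ren r (quant b xs f) = quant b (map r xs) (ren r f).
Proof. by case: b; rewrite /= /quant; elim: xs => //= x xs ->. Qed.

Lemma level_ren r b n f : level b n f -> level b n (ren r f).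
Proof.
elim: n b f => [|n IH] b f.
  rewrite !level0; elim: f => //= g IHg h IHh /andP[/IHg-> /IHh->] //.
move/levelS=> [xs [g [-> /IH gl]]]; apply/levelS.
by exists (map r xs), (ren r g); rewrite ren_quant.
Qed.

Lemma level_neg b n f P : level b n f -> free_in P f ->
  exists g, [/\ level (~~ b) n g, free_in P g
    & forall M (e : nat -> M), sat M e g <-> ~ sat M e f].
Proof.
elim: n b f P => [|n IH] b f P.
  by rewrite level0 => fq fP; exists (FNot f); rewrite level0.
move/levelS=> [xs [g [-> gl]]] /free_in_quant /(IH _ _ _ gl)[h [hl hP hg]].
exists (quant (~~ b) xs h); split; first by apply/levelS; exists xs, h.
  exact/free_in_quant.
move=> M e; case: (b); rewrite /quant /=.
  apply: (iff_trans (sat_exs _ _ _)); split.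
    by move=> [e' [ag /hg ng]] /sat_alls /(_ _ ag).
  move=> nall; apply: contrapT => nex; apply: nall; apply/sat_alls => e' ag.
  by apply: contrapT => ng; apply: nex; exists e'; split=> //; apply/hg.
apply: (iff_trans (sat_alls _ _ _)); split.
  by move=> all /sat_exs[e' [/all/hg]].
move=> nex e' ag; apply/hg => sg; apply: nex; apply/sat_exs; by exists e'.
Qed.

(* The bound variables are moved above [K] by an injective map, so that
   applying it to every variable, free or bound, cannot capture. *)
Lemma fresh_block b n xs g P K :
  level (~~ b) n g -> free_in P (quant b xs g) ->
  free_in (fun x => x < K) (quant b xs g) ->
  exists ys h, [/\ level (~~ b) n h, free_in P (quant b ys h),
    forall y, y \in ys -> K <= y
    & forall M (e : nat -> M),
        sat M e (quant b ys h) = sat M e (quant b xs g)].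
Proof.
move=> gl gP gK.
(* Variables from [K] upwards are shifted too, so that no shifted bound variable collides with one
   of them. *)
pose r x := if (x \in xs) || (K <= x) then x + K else x.
have r_inj : injective r.
  move=> x y; rewrite /r; case: ifP => [_|/norP[_ xK]]; case: ifP => [_|/norP[_ yK]].
  - by move/addIn.
  - by move=> xy; rewrite -xy leq_addl in yK.
  - by move=> xy; rewrite xy leq_addl in xK.
  - by [].
(* The free variables of the whole block formula lie below [K] and off [xs], so [r] fixes them. *)
have off : free_in (fun x => x \notin xs) (quant b xs g).
  by apply/free_in_quant/free_in_true => x; case: (x \in xs); auto.
have {gK off}fv := free_in_and gP (free_in_and gK off).
have r_id x : P x /\ x < K /\ x \notin xs -> r x = x.
  by case=> _ [xK xxs]; rewrite /r (negbTE xxs) leqNgt xK.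
exists (map r xs), (ren r g); rewrite -ren_quant; split.
- exact: level_ren.
- by apply: free_in_mono (free_in_ren r fv) => _ [x Px ->]; rewrite r_id; case: Px.
- by move=> _ /mapP[x xxs ->]; rewrite /r xxs leq_addl.
- by move=> M e; rewrite sat_ren //; apply: sat_ext fv _ => x /r_id /= ->.
Qed.

Lemma sat_quant_and b xs f g h M (e : nat -> M) :
  (forall e : nat -> M, sat M e f <-> sat M e g /\ sat M e h) ->
  free_in (fun x => x \notin xs) g ->
  sat M e (quant b xs f) <-> sat M e g /\ sat M e (quant b xs h).
Proof.
move=> fE gxs.
have gE e' : agree_off xs e e' -> sat M e' g = sat M e g by exact: sat_ext gxs.
case: b; rewrite /quant.
  split=> [/sat_alls sf|[sg /sat_alls sh]]; last first.
    apply/sat_alls => e' ag; apply/fE; split; [by rewrite gE | exact: sh].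
  split; first by case/fE: (sf e (fun _ _ => erefl)).
  by apply/sat_alls => e' /sf/fE[].
split=> [/sat_exs[e' [ag /fE[]]]|[sg /sat_exs[e' [ag sh]]]].
  by rewrite gE // => sg sh; split=> //; apply/sat_exs; exists e'.
by apply/sat_exs; exists e'; split=> //; apply/fE; rewrite gE.
Qed.

(** Two blocks of the same kind are renamed apart and concatenated, and the kernels are joined by
    induction; hence conjunction adds no alternation. *)
Lemma level_and b n f g P :
  level b n f -> level b n g -> free_in P f -> free_in P g ->
  exists h, [/\ level b n h, free_in P h
    & forall M (e : nat -> M), sat M e h <-> sat M e f /\ sat M e g].
Proof.
elim: n b f g P => [|n IH] b f g P.
  rewrite !level0 => fq gq fP gP; exists (FAnd f g).
  by rewrite level0 /= fq gq.
have low (xs : seq nat) K (k : form ar) : free_in (fun x => x < K) k ->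
    (forall x, x \in xs -> K <= x) -> free_in (fun x => x \notin xs) k.
  move=> kK xsK; apply: free_in_mono kK => x.
  by rewrite ltnNge; apply: contra => /xsK.
have bound (k l : form ar) :
    exists K, free_in (fun x => x < K) k /\ free_in (fun x => x < K) l.
  by have [K ] := free_in_bounded (FAnd k l); exists K.
move=> /levelS[xs [f1 [-> f1l]]] /levelS[ys [g1 [-> g1l]]] fP gP.
have [K [fK gK]] := bound (quant b xs f1) (quant b ys g1).
have [xs' [f2 [f2l f2P /(low _ _ _ gK) xs'g f2E]]] := fresh_block f1l fP fK.
have [L [f2L gL]] := bound f2 (quant b ys g1).
(* The second block is placed above the free variables of [f2], among which may be variables of the
   first block. *)
have [ys' [g2 [g2l g2P /(low _ _ _ f2L) ys'f g2E]]] := fresh_block g1l gP gL.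
have [||h [hl hP hE]] := IH (~~ b) f2 g2 (fun x => x \in xs' ++ ys' \/ P x) f2l g2l.
- move/free_in_quant: f2P; apply: free_in_mono => x; rewrite mem_cat.
  by case=> [->|]; auto.
- move/free_in_quant: g2P; apply: free_in_mono => x; rewrite mem_cat.
  by case=> [->|]; rewrite ?orbT; auto.
exists (quant b (xs' ++ ys') h); split.
- by apply/levelS; exists (xs' ++ ys'), h.
- exact/free_in_quant.
move=> M e; rewrite quant_cat -f2E.
(* The outer block passes over [quant b ys g1], the inner one over [f2]. *)
apply: iff_trans (and_comm _ _); apply: sat_quant_and => // e'.
rewrite -g2E; apply: iff_trans (and_comm _ _); exact: sat_quant_and.
Qed.

End Syntax.

(** * Ultraproducts *)

Record nonprincipal (U : (nat -> Prop) -> Prop) : Prop := Nonprincipal {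
  ultraS : forall A B : nat -> Prop, (forall i, A i -> B i) -> U A -> U B;
  ultraI : forall A B : nat -> Prop, U A -> U B -> U (fun i => A i /\ B i);
  ultraN : forall A : nat -> Prop, U (fun i => ~ A i) <-> ~ U A;
  ultra_tail : forall m, U (fun i => m <= i) }.

Lemma nonprincipal_exists : exists U, nonprincipal U.
Proof.
have [U [UU tailU]] := ultraFilterLemma eventually_filter.
have UP : ProperFilter U by apply: ultra_proper.
exists U; split.
- by move=> A B AB; apply: filterS.
- by move=> A B; apply: filterI.
- move=> A; split=> [UNA UA|NUA].
    by apply: (@filter_not_empty _ U); apply: filterS (filterI UA UNA) => i [].
  by have [|] := in_ultra_setVsetC A UU.
- by move=> m; apply: tailU; exists m.
Qed.

(** The default [x0] lets choice produce a total Skolem function, correct wherever a witness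
    exists. *)
Lemma total_witness (T : Type) (P : T -> Prop) (x0 : T) :
  exists x, (exists y, P y) -> P x.
Proof.
by have [[x Px]|nP] := pselect (exists y, P y); [exists x | exists x0].
Qed.

Lemma choice_dep (I : Type) (T : I -> Type) (P : forall i, T i -> Prop) :
  (forall i, exists x, P i x) -> exists f : forall i, T i, forall i, P i (f i).
Proof. by move=> Pex; exists (fun i => sval (cid (Pex i))) => i; case: cid. Qed.

Section Quotient.
Variables (T : Type) (R : T -> T -> Prop).

(** Classes are the predicates [R x] themselves; extensionality and proof irrelevance identify equal
    classes. *)
Definition quot : Type := {P : T -> Prop | exists x, P = R x}.
Definition class_of (x : T) : quot := exist _ (R x) (ex_intro _ x erefl).
Definition repr_of (q : quot) : T := sval (cid (svalP q)).

Lemma repr_ofK : cancel repr_of class_of.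
Proof.
move=> q; apply: eq_sig_hprop => [P p1 p2|]; first exact: Prop_irrelevance.
by rewrite /repr_of /=; case: cid.
Qed.

Lemma class_ofP (x y : T) :
  (forall x, R x x) -> (forall x y, R x y -> R y x) ->
  (forall x y z, R x y -> R y z -> R x z) ->
  class_of x = class_of y <-> R x y.
Proof.
move=> Rr Rs Rt; split=> [[->]//|Rxy].
apply: eq_sig_hprop => [P p1 p2|]; [exact: Prop_irrelevance | rewrite /=].
by apply: funext => z; apply: propext; split; apply: Rt => //; apply: Rs.
Qed.

End Quotient.

Section Ultraproducts.
Variables (S : countType) (ar : S -> nat).
Implicit Types (f g : form ar) (M : structure ar).

(** Embeds formulas into a countable type; the node labels tell the constructors apart. *)
Fixpoint form_tree f : GenTree.tree nat :=
  match f with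
  | FEq x y => GenTree.Node 0 [:: GenTree.Leaf x; GenTree.Leaf y]
  | FRel s t =>
      GenTree.Node 1 (GenTree.Leaf (pickle s) :: map (@GenTree.Leaf nat) t)
  | FNot g => GenTree.Node 2 [:: form_tree g]
  | FAnd g h => GenTree.Node 3 [:: form_tree g; form_tree h]
  | FOr g h => GenTree.Node 4 [:: form_tree g; form_tree h]
  | FEx x g => GenTree.Node 5 [:: GenTree.Leaf x; form_tree g]
  | FAll x g => GenTree.Node 6 [:: GenTree.Leaf x; form_tree g]
  end.

Lemma form_tree_inj : injective form_tree.
Proof.
elim=> [x y|s t|g IH|g IHg h IHh|g IHg h IHh|x g IH|x g IH];
  case=> [x' y'|s' t'|g'|g' h'|g' h'|x' g'|x' g'] //=.
- by case=> -> ->.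
(* The symbols are identified first, since the tuple types depend on their arities. *)
- case=> /(pcan_inj pickleK) ss; case: _ / ss t' => t' tt.
  congr FRel; apply: val_inj; apply: (inj_map _ tt) => x y; by case.
- by case=> /IH->.
- by case=> /IHg-> /IHh->.
- by case=> /IHg-> /IHh->.
- by case=> -> /IH->.
- by case=> -> /IH->.
Qed.

Definition code f : nat := pickle (form_tree f).

Lemma code_inj : injective code.
Proof. exact: inj_comp (pcan_inj pickleK) form_tree_inj. Qed.

(* Saturation for types in finitely many new variables [xs] over the countable
   set of parameters listed by [e]; finite satisfiability is tested on the
   initial segments of the enumeration of formulas by [code]. *)
Definition saturated M : Prop :=
  forall (e : nat -> M) (xs : seq nat) (G : form ar -> Prop),
  (forall m, exists e', agree_off xs e e' /\
     forall f, code f < m -> G f -> sat M e' f) ->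
  exists e', agree_off xs e e' /\ forall f, G f -> sat M e' f.

Section Fixed.
Variables (U : (nat -> Prop) -> Prop) (Mk : nat -> structure ar).
Hypothesis npU : nonprincipal U.

Let ultraT (A : nat -> Prop) : (forall i, A i) -> U A.
Proof. by move=> AT; apply: (ultraS npU) (ultra_tail npU 0) => i _. Qed.

(** As [code] is injective, only finitely many formulas have code below [m], and [U] is closed under
    finite intersections. *)
Let ultra_codes (A : form ar -> nat -> Prop) (G : form ar -> Prop) m :
  (forall f, code f < m -> G f -> U (A f)) ->
  U (fun i => forall f, code f < m -> G f -> A f i).
Proof.
elim: m => [|m IH] UA; first exact: ultraT.
have {}IH := IH (fun f fm => UA f (ltnW fm)).
have [[f [fm Gf]]|nof] := pselect (exists f, code f = m /\ G f).
  have UAf : U (A f) by apply: UA => //; rewrite fm.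
  apply: (ultraS npU) (ultraI npU IH UAf) => i [Ai Afi] g.
  rewrite ltnS leq_eqVlt => /orP[/eqP gm _|/Ai//].
  by rewrite (_ : g = f) //; apply: code_inj; rewrite fm.
apply: (ultraS npU) IH => i Ai g; rewrite ltnS leq_eqVlt => /orP[/eqP gm Gg|/Ai//].
by case: nof; exists g.
Qed.

Let prodM := forall k, Mk k.
Let aeq (a b : prodM) : Prop := U (fun k => a k = b k).
Let pi : prodM -> quot aeq := @class_of _ aeq.
Let repr : quot aeq -> prodM := @repr_of _ aeq.

(** Relations are evaluated on chosen representatives; any other members of the classes agree with
    them on a set in [U]. *)
Definition ultraproduct : structure ar :=
  Structure (pi (fun k => inhab (Mk k)))
    (fun s t => U (fun k => interp (map_tuple (fun q => repr q k) t))).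

Let piP a b : pi a = pi b <-> aeq a b.
Proof.
apply: class_ofP => [x|x y|x y z].
- exact: ultraT.
- by apply: (ultraS npU) => i.
- by move=> xy yz; apply: (ultraS npU) (ultraI npU xy yz) => i [-> ->].
Qed.

Let reprK : cancel repr pi.
Proof. exact: repr_ofK. Qed.

(** Łoś's theorem: [U] commutes with negation and conjunction, and witnesses chosen in each
    coordinate form one element of the product. Disjunction and universal quantification follow by
    duality. *)
Lemma los (E : nat -> prodM) f :
  sat ultraproduct (pi \o E) f <-> U (fun k => sat (Mk k) (fun x => E x k) f).
Proof.
have UE (A B : nat -> Prop) : U (fun k => A k <-> B k) -> U A <-> U B.
  by move=> AB; split=> [UA|UB]; [apply: (ultraS npU) (ultraI npU AB UA)
    | apply: (ultraS npU) (ultraI npU AB UB)] => k [[]]; auto.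
have updE (D : nat -> prodM) x a k :
    (fun y => upd D x a y k) = upd (fun y => D y k) x (a k).
  by apply: funext => y; rewrite /upd; case: eqP.
have los_ex g x (D : nat -> prodM) :
    (forall D', sat ultraproduct (pi \o D') g <->
                U (fun k => sat (Mk k) (fun x => D' x k) g)) ->
    sat ultraproduct (pi \o D) (FEx x g) <->
    U (fun k => sat (Mk k) (fun y => D y k) (FEx x g)).
  move=> IH; split=> [[m]|].
    rewrite -(reprK m) -upd_comp => /IH; apply: (ultraS npU) => k.
    by rewrite updE; exists (repr m k).
  have [a aP] := choice_dep (fun k => total_witness (fun m : Mk k =>
    sat (Mk k) (upd (fun y => D y k) x m) g) (inhab (Mk k))).
  move=> UD; exists (pi a); rewrite -upd_comp; apply/IH.
  by apply: (ultraS npU) UD => k; rewrite updE; apply: aP.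
have los_neg g (D : nat -> prodM) :
    (sat ultraproduct (pi \o D) g <->
     U (fun k => sat (Mk k) (fun x => D x k) g)) ->
    sat ultraproduct (pi \o D) (FNot g) <->
    U (fun k => sat (Mk k) (fun x => D x k) (FNot g)).
  by move=> IH; apply: (iff_trans _ (iff_sym (ultraN npU _))); split=> nA /IH.
have los_and g h (D : nat -> prodM) :
    (sat ultraproduct (pi \o D) g <->
     U (fun k => sat (Mk k) (fun x => D x k) g)) ->
    (sat ultraproduct (pi \o D) h <->
     U (fun k => sat (Mk k) (fun x => D x k) h)) ->
    sat ultraproduct (pi \o D) (FAnd g h) <->
    U (fun k => sat (Mk k) (fun x => D x k) (FAnd g h)).
  move=> IHg IHh; split=> [[/IHg Ug /IHh Uh]|Ugh]; first exact: ultraI.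
  by split; [apply/IHg | apply/IHh]; apply: (ultraS npU) Ugh => k [].
have dual g h : (forall M (e : nat -> M), sat M e g <-> sat M e h) ->
    (forall D : nat -> prodM, sat ultraproduct (pi \o D) h <->
      U (fun k => sat (Mk k) (fun x => D x k) h)) ->
    forall D : nat -> prodM, sat ultraproduct (pi \o D) g <->
      U (fun k => sat (Mk k) (fun x => D x k) g).
  move=> gh IH D; apply: (iff_trans (gh _ _)); apply: (iff_trans (IH _)).
  by apply: UE; apply: ultraT => k; apply: iff_sym.
elim: f E => [x y|s t|g IH|g IHg h IHh|g IHg h IHh|x g IH|x g IH] E.
- exact: piP.
- apply: UE => /=.
  (* The variables of [t] are finitely many, so at almost every coordinate all the representatives
     agree with [E] at once. *)
  have : U (fun k => forall x, x \in val t -> repr (pi (E x)) k = E x k).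
    elim: (val t) => [|x u IHu]; first exact: ultraT.
    have Ux : aeq (repr (pi (E x))) (E x) by apply/piP; rewrite reprK.
    apply: (ultraS npU) (ultraI npU Ux IHu) => k [xE uE] y.
    by rewrite in_cons => /orP[/eqP->|/uE].
  apply: (ultraS npU) => k tE.
  rewrite (_ : map_tuple _ (map_tuple _ t) = map_tuple (fun x => E x k) t) //.
  by apply: val_inj; rewrite /= -map_comp; apply/eq_in_map => x /tE.
- exact: los_neg.
- exact: los_and.
- apply: (dual _ (FNot (FAnd (FNot g) (FNot h)))) => [M e/=|D].
    split=> [[?|?] []//|/not_andP[]/contrapT]; by [left | right].
  by apply/los_neg; apply/los_and; apply/los_neg.
- exact: los_ex.
- apply: (dual _ (FNot (FEx x (FNot g)))) => [M e/=|D].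
    by split=> [ag [m]|nex m]; [apply | apply: contrapT => nm; apply: nex; exists m].
  by apply/los_neg; apply/los_ex => D'; apply/los_neg.
Qed.

(** Diagonalization: by Łoś's theorem each finite part of the type is realized at almost every
    coordinate, and coordinate [i] has to serve only segments of length at most [i]. *)
Lemma ultraproduct_saturated : saturated ultraproduct.
Proof.
move=> e xs G fin; pose E x := repr (e x).
pose X m i := exists a, agree_off xs (fun x => E x i) a /\
  forall f, code f < m -> G f -> sat (Mk i) a f.
have UX m : U (X m).
  have [e' [ag sG]] := fin m.
  have : U (fun i => forall f, code f < m -> G f ->
      sat (Mk i) (fun x => repr (e' x) i) f).
    apply: ultra_codes => f fm Gf; apply/los.
    by rewrite (_ : _ \o _ = e'); [exact: sG | apply: funext => x; exact: reprK].
  apply: (ultraS npU) => i sf; exists (fun x => repr (e' x) i); split=> //.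
  by move=> x xxs; rewrite ag.
(* At coordinate [i], realize as long an initial segment of [G], of length at
   most [i], as [Mk i] allows. *)
have pick i n : exists a : nat -> Mk i, agree_off xs (fun x => E x i) a /\
    forall m, m <= n -> X m i -> forall f, code f < m -> G f -> sat (Mk i) a f.
  elim: n => [|n [b [agb bP]]].
    by exists (fun x => E x i); split=> // m; rewrite leqn0 => /eqP->.
  have [[c [agc cP]]|nX] := pselect (X n.+1 i).
    by exists c; split=> // m mn _ f fm; apply: cP; exact: leq_trans fm mn.
  by exists b; split=> // m; rewrite leq_eqVlt => /orP[/eqP->//|/bP].
have [a aP] := choice_dep (fun i => pick i i).
exists (pi \o (fun x i => a i x)); split=> [x xxs|f Gf].
  rewrite -[RHS]reprK /=; apply/piP; apply: ultraT => i.
  by case: (aP i) => ag _; rewrite ag.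
apply/los; apply: (ultraS npU) (ultraI npU (UX (code f).+1) (ultra_tail npU (code f).+1)).
by move=> i [Xi mi]; case: (aP i) => _ /(_ _ mi Xi f (ltnSn _) Gf).
Qed.

End Fixed.

(** This plays the role of compactness: each formula need only hold from some index on, and the
    limit is saturated as well. *)
Lemma saturated_limit (Mk : nat -> structure ar) (ek : forall k, nat -> Mk k) :
  exists M (e : nat -> M), saturated M /\
    forall f, (exists m, forall k, m <= k -> sat (Mk k) (ek k) f) -> sat M e f.
Proof.
have [U npU] := nonprincipal_exists.
exists (ultraproduct U Mk), (@class_of _ _ \o (fun x k => ek k x)).
split=> [|f [m sf]]; first exact: ultraproduct_saturated.
by apply/los => //; apply: (ultraS npU) (ultra_tail npU m) => k /sf.
Qed.

End Ultraproducts.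

(** * Infinitary formulas *)

Section Infinitary.
Variables (S : countType) (ar : S -> nat).
Implicit Types (f g : form ar) (p q : iform ar) (M N : structure ar).
Implicit Types (P Q : nat -> Prop).

Lemma ifree_in_mono P Q p :
  (forall x, P x -> Q x) -> ifree_in P p -> ifree_in Q p.
Proof.
elim: p P Q => /= [f|p IH|F IH|F IH|x p IH|x p IH] P Q PQ.
- exact: free_in_mono.
- exact: IH.
- by move=> FP i; apply: IH (FP i).
- by move=> FP i; apply: IH (FP i).
- by apply: IH => y [->|/PQ]; [left|right].
- by apply: IH => y [->|/PQ]; [left|right].
Qed.

Lemma isat_ext P M (e e' : nat -> M) p :
  ifree_in P p -> (forall x, P x -> e x = e' x) -> isat M e p = isat M e' p.
Proof.
elim: p P e e' => /= [f|p IH|F IH|F IH|x p IH|x p IH] P e e'.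
- exact: sat_ext.
- by move=> pP /(IH _ _ _ pP)->.
- by move=> FP eq; apply: eq_forall => i; apply: IH (FP i) eq.
- by move=> FP eq; congr ex; apply: funext => i; apply: IH (FP i) eq.
- move=> pP eq; congr ex; apply: funext => m; apply: IH pP _ => y.
  by rewrite /upd; case: eqP => // yx [|/eq].
- move=> pP eq; apply: eq_forall => m; apply: IH pP _ => y.
  by rewrite /upd; case: eqP => // yx [|/eq].
Qed.

Lemma isat_ialls M (e : nat -> M) xs p :
  isat M e (ialls xs p) <-> forall e', agree_off xs e e' -> isat M e' p.
Proof. exact: (all_block (B := fun xs e => isat M e (ialls xs p))). Qed.

Lemma isat_iexs M (e : nat -> M) xs p :
  isat M e (iexs xs p) <-> exists e', agree_off xs e e' /\ isat M e' p.
Proof. exact: (ex_block (B := fun xs e => isat M e (iexs xs p))). Qed.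

Lemma ifree_in_block P xs p :
  ifree_in P (ialls xs p) \/ ifree_in P (iexs xs p) ->
  ifree_in (fun x => x \in xs \/ P x) p.
Proof.
elim: xs P => [|x xs IH] P /=.
  by case; apply: ifree_in_mono; right.
move=> h; apply: ifree_in_mono (IH _ h) => y; rewrite in_cons.
by case=> [->|[->|]]; rewrite ?eqxx ?orbT; auto.
Qed.

(** * Skolem functions and the downward Löwenheim-Skolem theorem *)

Section Skolem.
Variable M : structure ar.

Definition substructure (C : M -> Prop) (c0 : {m | C m}) : structure ar :=
  Structure c0 (fun s t => interp (map_tuple sval t)).

Definition closed_under (sk : nat -> seq M -> M) (C : M -> Prop) : Prop :=
  forall k (v : seq {m | C m}), C (sk k (map sval v)).

(* [sk] is a countable family of Skolem functions for the property [A]; their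
   arguments are the values of the finitely many free variables of [A]. *)
Definition reflected (A : forall N : structure ar, (nat -> N) -> Prop) : Prop :=
  exists sk, forall (C : M -> Prop) (c0 : {m | C m}), closed_under sk C ->
    forall e : nat -> substructure c0,
      A (substructure c0) e <-> A M (fun x => sval (e x)).

Implicit Type A : forall N : structure ar, (nat -> N) -> Prop.

Lemma reflected_iff A A' :
  (forall N (e : nat -> N), A N e <-> A' N e) -> reflected A -> reflected A'.
Proof.
move=> AA' [sk skP]; exists sk => C c0 cl e.
by apply: (iff_trans (iff_sym (AA' _ _))); apply: (iff_trans (skP _ _ cl _)).
Qed.

Lemma reflected_not A : reflected A -> reflected (fun N e => ~ A N e).
Proof. by move=> [sk skP]; exists sk => C c0 cl e; split=> + /(skP _ _ cl). Qed.

Lemma reflected_forall (A : nat -> forall N : structure ar, (nat -> N) -> Prop) :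
  (forall i, reflected (A i)) -> reflected (fun N e => forall i, A i N e).
Proof.
move=> /choice[sk skP].
(* Countably many countable families are merged along codes of pairs; [inhab M] fills the indices
   that code no pair. *)
exists (fun k v => if unpickle k is Some (i, j) then sk i j v else inhab M).
move=> C c0 cl e.
have cli i : closed_under (sk i) C.
  by move=> j v; have := cl (pickle (i, j)) v; rewrite pickleK.
by split=> Ai i; apply/(skP i _ c0 (cli i)).
Qed.

(** The Tarski-Vaught step: a new function, at index 0, picks a witness from the values of [xs], and
    the functions for [A] are shifted by one. *)
Lemma reflected_exists A x (xs : seq nat) :
  (forall e e' : nat -> M, (forall y, y \in x :: xs -> e y = e' y) ->
     A M e -> A M e') ->
  reflected A -> reflected (fun N e => exists m, A N (upd e x m)).
Proof.
move=> Aext [sk skP].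
(* Decodes a list of values for [xs] into an assignment, with [inhab M] elsewhere. *)
pose asg (v : seq M) y := nth (inhab M) v (index y xs).
have [w wP] := choice (fun v =>
  total_witness (fun m => A M (upd (asg v) x m)) (inhab M)).
exists (fun k v => if k is k'.+1 then sk k' v else w v) => C c0 cl e.
have clsk : closed_under sk C by move=> k v; apply: (cl k.+1).
have updE m : (fun y => sval (upd e x m y)) = upd (fun y => sval (e y)) x (sval m).
  by apply: funext => y; rewrite /upd; case: eqP.
split=> [[m /(skP _ _ clsk)]|[m Am]]; first by rewrite updE; exists (sval m).
pose v := map sval (map e xs).
have asgE y : y \in xs -> asg v y = sval (e y).
  move=> yxs; rewrite /asg /v -map_comp (nth_map 0) ?index_mem //.
  by rewrite /= nth_index.
have updA (d d' : nat -> M) m' : (forall y, y \in xs -> d y = d' y) ->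
    A M (upd d x m') -> A M (upd d' x m').
  move=> dd'; apply: Aext => y; rewrite in_cons /upd; case: eqP => //= _.
  exact: dd'.
exists (exist _ (w v) (cl 0 (map e xs))); apply/(skP _ _ clsk); rewrite updE /=.
by apply: (updA _ _ _ asgE); apply: wP; exists m; apply: updA Am => y /asgE.
Qed.

Lemma reflected_and A A' :
  reflected A -> reflected A' -> reflected (fun N e => A N e /\ A' N e).
Proof.
move=> rA rA'; pose B i := if i is 0 then A else A'.
apply: (reflected_iff (A := fun N e => forall i, B i N e)) => [N e|].
  by split=> [AB|[a a'] [|i]] //; split; [exact (AB 0) | exact (AB 1)].
by apply: reflected_forall => -[|i].
Qed.

Lemma reflected_sat (xs : seq nat) f :
  free_in (fun x => x \in xs) f -> reflected (fun N e => sat N e f).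
Proof.
have cons x ys g : free_in (fun y => y = x \/ y \in ys) g ->
    free_in (fun y => y \in x :: ys) g.
  apply: free_in_mono => y; rewrite in_cons.
  by case=> [->|->]; rewrite ?eqxx ?orbT.
elim: f xs => [x y|s t|g IH|g IHg h IHh|g IHg h IHh|x g IH|x g IH] xs.
- move=> _; exists (fun _ _ => inhab M) => C c0 _ e /=.
  by split=> [->//|exy]; apply: eq_sig_hprop => // ? ? ?; apply: Prop_irrelevance.
- move=> _; exists (fun _ _ => inhab M) => C c0 _ e /=.
  rewrite (_ : map_tuple _ (map_tuple e t) = map_tuple (fun x => sval (e x)) t) //.
  by apply: val_inj; rewrite /= -map_comp.
- by move=> /IH; apply: reflected_not.
- by case=> /IHg rg /IHh; apply: reflected_and.
- case=> /IHg rg /IHh rh.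
  apply: (reflected_iff (A := fun N e => ~ (~ sat N e g /\ ~ sat N e h))).
    by move=> N e; split=> [/not_andP[]/contrapT|[?|?] []] //; [left | right].
  by apply/reflected_not/reflected_and; apply: reflected_not.
- move=> /cons gx;
  apply: (reflected_exists (A := fun N d => sat N d g) (xs := xs));
    last exact: IH gx.
  by move=> e e' /(sat_ext gx)->.
- move=> /cons gx.
  apply: (reflected_iff (A := fun N e => ~ exists m, ~ sat N (upd e x m) g)).
    move=> N e; split=> [nex m|ag [m]]; last by apply.
    by apply: contrapT => ng; apply: nex; exists m.
  apply/reflected_not/(reflected_exists (A := fun N d => ~ sat N d g) (xs := xs)).
    by move=> e e' /(sat_ext gx)->.
  exact/reflected_not/(IH _ gx).
Qed.

(** Countable connectives need only countably many Skolem functions. Going under a quantifier adds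
    one variable to the finite list [xs], so every witness function has finitely many arguments. *)
Lemma reflected_isat (xs : seq nat) p :
  ifree_in (fun x => x \in xs) p -> reflected (fun N e => isat N e p).
Proof.
have cons x ys q : ifree_in (fun y => y = x \/ y \in ys) q ->
    ifree_in (fun y => y \in x :: ys) q.
  apply: ifree_in_mono => y; rewrite in_cons.
  by case=> [->|->]; rewrite ?eqxx ?orbT.
elim: p xs => [f|p IH|F IH|F IH|x p IH|x p IH] xs.
- exact: reflected_sat.
- by move=> /IH; apply: reflected_not.
- by move=> Fxs; apply: reflected_forall => i; apply: IH (Fxs i).
- move=> Fxs.
  apply: (reflected_iff (A := fun N e => ~ forall i, ~ isat N e (F i))).
    by move=> N e; apply: iff_sym; apply: not_existsP.
  by apply/reflected_not/reflected_forall => i; apply: reflected_not; apply: IH (Fxs i).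
- move=> /cons px;
  apply: (reflected_exists (A := fun N d => isat N d p) (xs := xs));
    last exact: IH px.
  by move=> e e' /(isat_ext px)->.
- move=> /cons px.
  apply: (reflected_iff (A := fun N e => ~ exists m, ~ isat N (upd e x m) p)).
    move=> N e; split=> [nex m|ap [m]]; last by apply.
    by apply: contrapT => np; apply: nex; exists m.
  apply/reflected_not/(reflected_exists (A := fun N d => ~ isat N d p) (xs := xs)).
    by move=> e e' /(isat_ext px)->.
  exact/reflected_not/(IH _ px).
Qed.

(** The Skolem hull of the range of [e] is countable, and [A] passes from it up to [M]. *)
Lemma lowenheim_skolem A (e : nat -> M) :
  reflected A ->
  (forall N, countable_structure N -> forall d : nat -> N, A N d) -> A M e.
Proof.
move=> [sk skP] cA.
(* Trees are Skolem terms: leaves name the values of [e], nodes apply Skolem functions. *)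
pose ev := fix ev (t : GenTree.tree nat) : M :=
  match t with
  | GenTree.Leaf x => e x
  | GenTree.Node k ts => sk k (map ev ts)
  end.
pose C m := exists t, ev t = m.
have cl : closed_under sk C.
  move=> k v; have [ts <-] : exists ts, map ev ts = map sval v.
    elim: v => [|[m [t tm]] v [ts IH]]; first by exists [::].
    by exists (t :: ts); rewrite /= IH tm.
  by exists (GenTree.Node k ts).
pose e' x : {m | C m} := exist _ (e x) (ex_intro _ (GenTree.Leaf x) erefl).
apply: (skP C (e' 0) cl e').1; apply: cA.
(* Each element of the hull is coded by a chosen term denoting it. *)
exists (fun m : {m | C m} => pickle (sval (cid (svalP m)))).
move=> m m' /(pcan_inj pickleK) tt.
apply: eq_sig_hprop => [? ? ?|]; first exact: Prop_irrelevance.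
by rewrite -(svalP (cid (svalP m))) -(svalP (cid (svalP m'))) tt.
Qed.

End Skolem.

(** * Preservation between saturated structures *)

Lemma level_qf b n f : qf f -> level b n f.
Proof.
move=> fq; elim: n b => [|n IH] b; first by rewrite level0.
by apply/levelS; exists [::], f; split=> //; case: b.
Qed.

(** At level 0 with [P] empty there may be no tautology to begin the conjunction with, hence the
    seed [f0]. *)
Lemma level_conj b n P (G : form ar -> Prop) m f0 :
  (forall f, G f -> level b n f /\ free_in P f) -> level b n f0 -> free_in P f0 ->
  exists g, [/\ level b n g, free_in P g
    & forall M (e : nat -> M), sat M e g <->
        sat M e f0 /\ forall f, code f < m -> G f -> sat M e f].
Proof.
move=> GP f0l f0P; elim: m => [|m [g [gl gP gE]]].
  by exists f0; split=> // M e; split=> [|[]].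
have [[f [fm Gf]]|nof] := pselect (exists f, code f = m /\ G f).
  have [fl fP] := GP _ Gf.
  have [h [hl hP hE]] := level_and gl fl gP fP.
  exists h; split=> // M e; apply: (iff_trans (hE _ _)); split.
    case=> /gE[s0 sG] sf; split=> // f'.
    rewrite ltnS leq_eqVlt => /orP[/eqP f'm _|]; last exact: sG.
    by rewrite (_ : f' = f) //; apply: code_inj; rewrite fm.
  case=> s0 sG; split; last by apply: sG => //; rewrite fm.
  by apply/gE; split=> // f' f'm; apply: sG; apply: ltnW.
exists g; split=> // M e; apply: (iff_trans (gE _ _)); split=> -[s0 sG].
  split=> // f; rewrite ltnS leq_eqVlt => /orP[/eqP fm Gf|]; last exact: sG.
  by case: nof; exists f.
by split=> // f fm; apply: sG; apply: ltnW.
Qed.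

(** One round of the back-and-forth. A finite part of the forall_n-type of [d], quantified
    existentially over [xs], holds at [e']; its negation is a forall_(n+1)-formula, which would be
    preserved if it held at [e]. Saturation of [M] then realizes the whole type. *)
Lemma saturated_step n P M N (e : nat -> M) (e' : nat -> N) xs d :
  saturated M ->
  (forall f, level true n.+1 f -> free_in P f -> sat M e f -> sat N e' f) ->
  agree_off xs e' d ->
  exists c, agree_off xs e c /\
    forall f, level true n f -> free_in (fun x => x \in xs \/ P x) f ->
      sat N d f -> sat M c f.
Proof.
move=> satM MN dag.
pose G f := [/\ level true n f, free_in (fun x => x \in xs \/ P x) f & sat N d f].
suff [c [cag cG]] : exists c, agree_off xs e c /\ forall f, G f -> sat M c f.
  by exists c; split=> // f fl fP fd; apply: cG.
apply: satM => m.
(* An empty type is realized by [e]; otherwise any member seeds the conjunction. *)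
have [[f0 Gf0]|nof] := pselect (exists f0, G f0); last first.
  by exists e; split=> // f _ Gf; case: nof; exists f.
have [f0l f0P f0d] := Gf0.
have [f [] //|g [gl gP gE]] := level_conj (G := G) m _ f0l f0P.
have exP : free_in P (quant false xs g) by apply/free_in_quant.
have exl : level false n.+1 (quant false xs g) by apply/levelS; exists xs, g.
suff /sat_exs[c [cag /gE[_ cG]]] : sat M e (quant false xs g) by exists c.
have [h [hl hP hE]] := level_neg exl exP.
apply: contrapT => /hE /(MN _ hl hP) /hE; apply.
by apply/sat_exs; exists d; split=> //; apply/gE; split=> // f _ [].
Qed.

(** Each round lowers [n] and reverses the direction of preservation, so the induction hypothesis is
    used with [M] and [N] exchanged; the Pi and Sigma halves must therefore be proved together. *)
Lemma saturated_transfer n P M N (e : nat -> M) (e' : nat -> N) :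
  saturated M -> saturated N ->
  (forall f, level true n f -> free_in P f -> sat M e f -> sat N e' f) ->
  (forall p, IPi n p -> ifree_in P p -> isat M e p -> isat N e' p) /\
  (forall p, ISigma n p -> ifree_in P p -> isat N e' p -> isat M e p).
Proof.
elim: n P M N e e' => [|n IH] P M N e e' satM satN MN; split=> p.
- by case=> f [-> fq] fP; apply: MN; rewrite ?level0.
- case=> f [-> fq] fP /=; apply: contraPP => nMf.
  exact: (MN (FNot f)).
- case=> F [-> FS] FP eF i; have [xs [q [Fi qS]]] := FS i.
  move: (eF i) (FP i); rewrite Fi => /isat_ialls eq qP; apply/isat_ialls => d dag.
  have [c [cag dc]] := saturated_step satM MN dag.
  apply: (IH _ _ _ _ _ satN satM dc).2 qS (ifree_in_block _) (eq _ cag).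
  by left.
- case=> F [-> FS] FP [i]; have [xs [q [Fi qS]]] := FS i.
  move: (FP i); rewrite Fi => qP /isat_iexs[d [dag dq]]; exists i; rewrite Fi.
  have [c [cag dc]] := saturated_step satM MN dag.
  apply/isat_iexs; exists c; split=> //.
  apply: (IH _ _ _ _ _ satN satM dc).1 qS (ifree_in_block _) dq.
  by right.
Qed.

End Infinitary.

(** * The two saturated models and the contradiction *)

Theorem theorem4p17 (S : countType) (ar : S -> nat) (n : nat)
  (xs : seq nat) (phi : form ar) (psi : iform ar) :
  0 < n ->
  free_in (fun x => x \in xs) phi ->
  ifree_in (fun x => x \in xs) psi ->
  IPi n psi ->
  (forall M : structure ar, countable_structure M ->
     forall e : nat -> M, sat M e phi <-> isat M e psi) ->
  exists theta : form ar,
    free_in (fun x => x \in xs) theta /\ ForallN n theta /\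
    (forall (M : structure ar) (e : nat -> M), sat M e theta <-> sat M e phi).
Proof.
move=> n_gt0 phi_xs psi_xs psi_Pi phi_psi_countable.
pose P (x : nat) : Prop := x \in xs.
have phi_psi (M : structure ar) (e : nat -> M) : sat M e phi <-> isat M e psi.
  apply: (lowenheim_skolem (A := fun N d => sat N d phi <-> isat N d psi)) => //.
  have r1 := reflected_sat M phi_xs; have r2 := reflected_isat M psi_xs.
  (* The equivalence is rewritten with negation and conjunction, under which [reflected] is
     closed. *)
  apply: (reflected_iff (A := fun N d =>
      ~ (sat N d phi /\ ~ isat N d psi) /\ ~ (isat N d psi /\ ~ sat N d phi))).
    move=> N d; split=> [[pq qp]|[pq qp]]; last by split=> -[h]; apply; auto.
    by split=> h; apply: contrapT => nh; [apply: pq | apply: qp].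
  by apply: reflected_and; apply: reflected_not; apply: reflected_and => //;
    apply: reflected_not.
apply: contrapT => no_theta.
(* Sentences true everywhere, as seeds for [level_conj]; with [0 < n] a block is available to bind
   the variable 0, which may lie outside [xs]. *)
pose top b := quant b [:: 0] (FEq ar 0 0).
have topP b : [/\ level b n (top b), free_in P (top b)
    & forall (M : structure ar) (e : nat -> M), sat M e (top b)].
  split; last by move=> M e; case: b => //=; exists (e 0).
    rewrite -(prednK n_gt0); apply/levelS; exists [:: 0], (FEq ar 0 0).
    by split=> //; apply: level_qf.
  by apply/free_in_quant; split; left.
pose G f := [/\ level true n f, free_in P f
  & forall (M : structure ar) (e : nat -> M), sat M e phi -> sat M e f].
have [Nk] : exists Nk : nat -> {N : structure ar & nat -> N}, forall k,
    (forall f, code f < k -> G f -> sat (tag (Nk k)) (tagged (Nk k)) f) /\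
    ~ sat (tag (Nk k)) (tagged (Nk k)) phi.
  suff /choice[Nk NkP] k : exists Ne : {N : structure ar & nat -> N},
      (forall f, code f < k -> G f -> sat (tag Ne) (tagged Ne) f) /\
      ~ sat (tag Ne) (tagged Ne) phi by exists Nk.
  have [tl tP tT] := topP true.
  have [f [] //|g [gl gP gE]] := level_conj (G := G) k _ tl tP.
  (* Were there no such model, the finite conjunction [g] would imply [phi] and serve as [theta]. *)
  apply: contrapT => none; apply: no_theta; exists g; split=> //; split=> // M e.
  split=> [/gE[_ eG]|ephi]; last by apply/gE; split=> // f _ [_ _]; apply.
  apply: contrapT => nphi; apply: none.
  by exists (existT (fun N : structure ar => nat -> N) M e).
move=> NkP.
have [N [b [satN Nb]]] := saturated_limit (fun k => tagged (Nk k)).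
have bG f : G f -> sat N b f.
  by move=> Gf; apply: Nb; exists (code f).+1 => k fk; apply: (NkP k).1.
have {Nb}bphi : ~ sat N b phi.
  by apply: (Nb (FNot phi)); exists 0 => k _; apply: (NkP k).2.
pose D f := [/\ level false n f, free_in P f & sat N b f].
have [Mk MkP] : exists Mk : nat -> {M : structure ar & nat -> M}, forall k,
    (forall f, code f < k -> D f -> sat (tag (Mk k)) (tagged (Mk k)) f) /\
    sat (tag (Mk k)) (tagged (Mk k)) phi.
  suff /choice[Mk MkP] k : exists Me : {M : structure ar & nat -> M},
      (forall f, code f < k -> D f -> sat (tag Me) (tagged Me) f) /\
      sat (tag Me) (tagged Me) phi by exists Mk.
  have [tl tP tT] := topP false.
  have [f [] //|g [gl gP gE]] := level_conj (G := D) k _ tl tP.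
  have [h [hl hP hE]] := level_neg gl gP.
  (* If [g] were inconsistent with [phi], its negation [h] would be a forall_n-consequence of [phi],
     hence true at [b], where [g] holds. *)
  apply: contrapT => none.
  have /hE : sat N b h.
    apply: bG; split=> // M e ephi; apply/hE => /gE[_ eD]; apply: none.
    by exists (existT (fun M : structure ar => nat -> M) M e).
  by apply; apply/gE; split=> // f _ [].
have [M [a [satM Ma]]] := saturated_limit (fun k => tagged (Mk k)).
have aphi : sat M a phi by apply: Ma; exists 0 => k _; apply: (MkP k).2.
have aD f : D f -> sat M a f.
  by move=> Df; apply: Ma; exists (code f).+1 => k fk; apply: (MkP k).1.
have MN f : level true n f -> free_in P f -> sat M a f -> sat N b f.
  move=> fl fP af; apply: contrapT => nbf.
  have [h [hl hP hE]] := level_neg fl fP.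
  by have /hE : sat M a h by apply: aD; split=> //; apply/hE.
apply: bphi; apply/phi_psi.
by apply: (saturated_transfer satM satN MN).1 => //; apply/phi_psi.
Qed.
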